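(* Let $R$ be a commutative ring containing a field of positive characteristic $p$ and let $X_{\mathrm{frob}}=(\operatorname{Spec} R)_{\mathrm{frob}}$ be $X=\operatorname{Spec} R$ endowed with the Frobenius topology. Let $M$ be an $R$-module with corresponding sheaf $M_{\mathrm{frob}}$ in the Frobenius topology. Then for every finite Frobenius cover $Y\to X$ (i.e. for every object of the Frobenius topology) we have $$\Gamma(Y_{\mathrm{frob}},M_{\mathrm{frob}})=M\otimes_RR^{\infty}.$$ In particular, $\Gamma(X_{\mathrm{frob}},\mathcal O_{\mathrm{frob}})=R^\infty$.
   Context: For $e\in\mathbb N$ let ${}^eR$ be the ring $R$ considered as an $R$-algebra via the $e$-th iterate of the Frobenius $f\mapsto f^p$. $R^\infty=\varinjlim_{e\in\mathbb N}{}^eR$ is the perfect closure of $R$ (transition maps given by Frobenius). For a scheme $U$ of characteristic $p$ let ${}^eU\to U$ be the $e$-th iterate of the absolute Frobenius morphism. A finite morphism $V\to U$ of finite type of schemes of characteristic $p$ is a finite Frobenius cover if there are $e\in\mathbb N$ and a factorization ${}^eU\to V\to U$ of the $e$-th iterate of the absolute Frobenius such that ${}^eU\to V$ is surjective. Frobenius topology on a scheme $X$ of characteristic $p$: the category consists of schemes over $X$ where all morphisms (including the structural morphisms to $X$) are finite Frobenius covers; each such single morphism is a covering. $M_{\mathrm{frob}}$ is the sheafification of the presheaf $\operatorname{Spec} S\mapsto M\otimes_RS$ and $\mathcal O_{\mathrm{frob}}=R_{\mathrm{frob}}$. *)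

(* Defs.v *)
From HB Require Import structures.
From mathcomp Require Import all_boot all_algebra.
From mathcomp Require Import boolp.
From mathcomp Require Import freeg.

Set Implicit Arguments.
Unset Strict Implicit.
Unset Printing Implicit Defensive.

Import GRing.Theory.
Local Open Scope ring_scope.
Local Open Scope quotient_scope.

Section PerfectClosure.
Variables (R : comNzRingType) (p : nat).

(* A pair (e, x) stands for x seen in the e-th copy of R in the direct system
   R -> R -> R -> ... all of whose maps are the Frobenius; (e, x) and (e', x')
   are identified when they become equal in a later copy. *)
Definition pc_equiv (u v : nat * R) : bool :=
  `[< exists a b, (u.1 + a = v.1 + b)%N /\ u.2 ^+ (p ^ a) = v.2 ^+ (p ^ b) >].

Lemma pc_equiv_refl : reflexive pc_equiv.
Proof. by move=> u; apply/asboolP; exists 0%N, 0%N. Qed.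

Lemma pc_equiv_sym : symmetric pc_equiv.
Proof.
by move=> u v; apply/asboolP/asboolP => -[a [b [h1 h2]]]; exists b, a.
Qed.

Lemma pc_equiv_trans : transitive pc_equiv.
Proof.
move=> v u w /asboolP[a [b [h1 h2]]] /asboolP[c [d [h3 h4]]]; apply/asboolP.
exists (a + c)%N, (d + b)%N; split; first by rewrite addnA h1 addnAC h3 addnA.
by rewrite !expnD !exprM h2 -h4 -!exprM mulnC.
Qed.

Canonical pc_equivRel := EquivRel pc_equiv pc_equiv_refl pc_equiv_sym pc_equiv_trans.

Definition perfect_closure of p \in [pchar R] := {eq_quot pc_equiv}.

Variable pR : p \in [pchar R].
Local Notation Rinf := (perfect_closure pR).

HB.instance Definition _ := Choice.on Rinf.
HB.instance Definition _ := EqQuotient.on Rinf.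

Local Lemma frobD e (x y : R) : (x + y) ^+ (p ^ e) = x ^+ (p ^ e) + y ^+ (p ^ e).
Proof.
apply: exprDn_pchar; rewrite (eq_pnat _ (pcharf_eq pR)) pnatX pnat_id //.
exact: pcharf_prime pR.
Qed.

Local Lemma frobN e (x : R) : (- x) ^+ (p ^ e) = - x ^+ (p ^ e).
Proof.
apply: exprNn_pchar; rewrite (eq_pnat _ (pcharf_eq pR)) pnatX pnat_id //.
exact: pcharf_prime pR.
Qed.

Local Lemma frob0 e : (0 : R) ^+ (p ^ e) = 0.
Proof. by rewrite expr0n expn_eq0; case: p (pcharf_prime pR). Qed.

Local Lemma frobX a b (x : R) : (x ^+ (p ^ a)) ^+ (p ^ b) = x ^+ (p ^ (a + b)).
Proof. by rewrite expnD exprM. Qed.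

Local Lemma pc_eqP u v :
  reflect (exists a b, (u.1 + a = v.1 + b)%N /\ u.2 ^+ (p ^ a) = v.2 ^+ (p ^ b))
          (\pi_Rinf u == \pi_Rinf v).
Proof. by rewrite (eqmodE pc_equivRel); apply: asboolP. Qed.

Local Lemma pc_stepn e n x : \pi_Rinf ((e + n)%N, x ^+ (p ^ n)) = \pi_Rinf (e, x).
Proof. by apply/eqP/pc_eqP; exists 0%N, n; rewrite addn0 expn0 expr1. Qed.

Lemma pc_step e x : \pi_Rinf (e.+1, x ^+ p) = \pi_Rinf (e, x).
Proof. by rewrite -(pc_stepn e 1) addn1 expn1. Qed.

Local Lemma pc_ex2 (u v : Rinf) : exists e x y, u = \pi_Rinf (e, x) /\ v = \pi_Rinf (e, y).
Proof.
elim/quotW: u => -[e x]; elim/quotW: v => -[e' y].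
exists (e + e')%N, (x ^+ (p ^ e')), (y ^+ (p ^ e)).
by rewrite pc_stepn addnC pc_stepn.
Qed.

Local Lemma pc_ex3 (u v w : Rinf) : exists e x y z,
  [/\ u = \pi_Rinf (e, x), v = \pi_Rinf (e, y) & w = \pi_Rinf (e, z)].
Proof.
have [e [x [y [-> ->]]]] := pc_ex2 u v; elim/quotW: w => -[e' z].
exists (e + e')%N, (x ^+ (p ^ e')), (y ^+ (p ^ e')), (z ^+ (p ^ e)).
by rewrite !pc_stepn addnC pc_stepn.
Qed.

Definition pc_add_r (u v : nat * R) :=
  ((u.1 + v.1)%N, u.2 ^+ (p ^ v.1) + v.2 ^+ (p ^ u.1)).
Definition pc_mul_r (u v : nat * R) :=
  ((u.1 + v.1)%N, u.2 ^+ (p ^ v.1) * v.2 ^+ (p ^ u.1)).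
Definition pc_opp_r (u : nat * R) := (u.1, - u.2).
Definition pc_scale_r (a : R) (u : nat * R) := (u.1, a ^+ (p ^ u.1) * u.2).

Definition pc_add (u v : Rinf) : Rinf := \pi_Rinf (pc_add_r (repr u) (repr v)).
Definition pc_mul (u v : Rinf) : Rinf := \pi_Rinf (pc_mul_r (repr u) (repr v)).
Definition pc_opp (u : Rinf) : Rinf := \pi_Rinf (pc_opp_r (repr u)).
Definition pc_scale (a : R) (u : Rinf) : Rinf := \pi_Rinf (pc_scale_r a (repr u)).
Definition pc_zero : Rinf := \pi_Rinf (0%N, 0).
Definition pc_one : Rinf := \pi_Rinf (0%N, 1).

Local Lemma pc_congr (f : nat * R -> nat * R) :
    (forall e x n, \pi_Rinf (f ((e + n)%N, x ^+ (p ^ n))) = \pi_Rinf (f (e, x))) ->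
  forall u v, \pi_Rinf u = \pi_Rinf v -> \pi_Rinf (f u) = \pi_Rinf (f v).
Proof.
move=> fS [e x] [e' y] /eqP/pc_eqP[a [b /= [h1 h2]]].
by rewrite -(fS e x a) -(fS e' y b) h1 h2.
Qed.

Local Lemma pc_add_rC u v : pc_add_r u v = pc_add_r v u.
Proof. by rewrite /pc_add_r addnC addrC. Qed.

Local Lemma pc_mul_rC u v : pc_mul_r u v = pc_mul_r v u.
Proof. by rewrite /pc_mul_r addnC mulrC. Qed.

Local Lemma pc_pi_add u v : pc_add (\pi_Rinf u) (\pi_Rinf v) = \pi_Rinf (pc_add_r u v).
Proof.
have H w : forall u v, \pi_Rinf u = \pi_Rinf v ->
    \pi_Rinf (pc_add_r u w) = \pi_Rinf (pc_add_r v w).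
  move=> u1 v1; apply: (pc_congr (f := pc_add_r^~ w)) => e x n; rewrite /pc_add_r /= frobX.
  by rewrite -[RHS](pc_stepn _ n) /= frobD !frobX addnAC (addnC n).
rewrite /pc_add (H _ _ u) ?reprK // pc_add_rC (H _ _ v) ?reprK //.
by rewrite pc_add_rC.
Qed.

Local Lemma pc_pi_mul u v : pc_mul (\pi_Rinf u) (\pi_Rinf v) = \pi_Rinf (pc_mul_r u v).
Proof.
have H w : forall u v, \pi_Rinf u = \pi_Rinf v ->
    \pi_Rinf (pc_mul_r u w) = \pi_Rinf (pc_mul_r v w).
  move=> u1 v1; apply: (pc_congr (f := pc_mul_r^~ w)) => e x n; rewrite /pc_mul_r /= frobX.
  by rewrite -[RHS](pc_stepn _ n) /= exprMn !frobX addnAC (addnC n).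
rewrite /pc_mul (H _ _ u) ?reprK // pc_mul_rC (H _ _ v) ?reprK //.
by rewrite pc_mul_rC.
Qed.

Local Lemma pc_addE e x y :
  pc_add (\pi_Rinf (e, x)) (\pi_Rinf (e, y)) = \pi_Rinf (e, x + y).
Proof. by rewrite pc_pi_add -[RHS](pc_stepn e e) frobD. Qed.

Local Lemma pc_mulE e x y :
  pc_mul (\pi_Rinf (e, x)) (\pi_Rinf (e, y)) = \pi_Rinf (e, x * y).
Proof. by rewrite pc_pi_mul -[RHS](pc_stepn e e) exprMn. Qed.

Local Lemma pc_oppE e x : pc_opp (\pi_Rinf (e, x)) = \pi_Rinf (e, - x).
Proof.
rewrite -[RHS]/(\pi_Rinf (pc_opp_r (e, x))); apply: (pc_congr (f := pc_opp_r)); last exact: reprK.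
move=> {}e {}x n.
by rewrite /pc_opp_r -[RHS](pc_stepn _ n) frobN.
Qed.

Local Lemma pc_scaleE a e x :
  pc_scale a (\pi_Rinf (e, x)) = \pi_Rinf (e, a ^+ (p ^ e) * x).
Proof.
rewrite -[RHS]/(\pi_Rinf (pc_scale_r a (e, x))).
apply: (pc_congr (f := pc_scale_r a)); last exact: reprK.
move=> {}e {}x n.
by rewrite /pc_scale_r /= -[RHS](pc_stepn _ n) exprMn frobX.
Qed.

Local Lemma pc_zeroE e : pc_zero = \pi_Rinf (e, 0).
Proof. by rewrite /pc_zero -(pc_stepn 0 e) frob0. Qed.

Local Lemma pc_oneE e : pc_one = \pi_Rinf (e, 1).
Proof. by rewrite /pc_one -(pc_stepn 0 e) expr1n. Qed.

Local Lemma pc_addA : associative pc_add.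
Proof.
move=> u v w; have [e [x [y [z [-> -> ->]]]]] := pc_ex3 u v w.
by rewrite !pc_addE addrA.
Qed.

Local Lemma pc_addC : commutative pc_add.
Proof.
by move=> u v; have [e [x [y [-> ->]]]] := pc_ex2 u v; rewrite !pc_addE addrC.
Qed.

Local Lemma pc_add0 : left_id pc_zero pc_add.
Proof. by elim/quotW => -[e x]; rewrite (pc_zeroE e) pc_addE add0r. Qed.

Local Lemma pc_addN : left_inverse pc_zero pc_opp pc_add.
Proof.
by elim/quotW => -[e x]; rewrite pc_oppE pc_addE addNr -pc_zeroE.
Qed.

HB.instance Definition _ := GRing.isZmodule.Build Rinf pc_addA pc_addC pc_add0 pc_addN.

Local Lemma pc_mulA : associative pc_mul.
Proof.
move=> u v w; have [e [x [y [z [-> -> ->]]]]] := pc_ex3 u v w.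
by rewrite !pc_mulE mulrA.
Qed.

Local Lemma pc_mulC : commutative pc_mul.
Proof.
by move=> u v; have [e [x [y [-> ->]]]] := pc_ex2 u v; rewrite !pc_mulE mulrC.
Qed.

Local Lemma pc_mul1 : left_id pc_one pc_mul.
Proof. by elim/quotW => -[e x]; rewrite (pc_oneE e) pc_mulE mul1r. Qed.

Local Lemma pc_mulD : left_distributive pc_mul +%R.
Proof.
move=> u v w; have [e [x [y [z [-> -> ->]]]]] := pc_ex3 u v w.
by rewrite /GRing.add /= !(pc_addE, pc_mulE) mulrDl.
Qed.

Local Lemma pc_one_neq0 : pc_one != 0.
Proof.
apply/eqP => /eqP/pc_eqP[a [b /= [_ /eqP]]].
by rewrite expr1n frob0 oner_eq0.
Qed.

HB.instance Definition _ := GRing.Zmodule_isComNzRing.Build Rinf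
  pc_mulA pc_mulC pc_mul1 pc_mulD pc_one_neq0.

Local Lemma pc_scaleA a b u : pc_scale a (pc_scale b u) = pc_scale (a * b) u.
Proof. by elim/quotW: u => -[e x]; rewrite (pc_scaleE b) 2!pc_scaleE exprMn mulrA. Qed.

Local Lemma pc_scale1 : left_id 1 pc_scale.
Proof. by elim/quotW => -[e x]; rewrite pc_scaleE expr1n mul1r. Qed.

Local Lemma pc_scaleDr : right_distributive pc_scale +%R.
Proof.
move=> a u v; have [e [x [y [-> ->]]]] := pc_ex2 u v.
by rewrite /GRing.add /= !(pc_scaleE, pc_addE) mulrDr.
Qed.

Local Lemma pc_scaleDl u : {morph pc_scale^~ u : a b / a + b}.
Proof.
move=> a b; elim/quotW: u => -[e x].
by rewrite [RHS]/GRing.add /= !pc_scaleE pc_addE frobD mulrDl.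
Qed.

HB.instance Definition _ := GRing.Zmodule_isLmodule.Build R Rinf
  pc_scaleA pc_scale1 pc_scaleDr pc_scaleDl.

Local Lemma pc_scaleAl a (u v : Rinf) : a *: (u * v) = (a *: u) * v.
Proof.
have [e [x [y [-> ->]]]] := pc_ex2 u v.
by rewrite /GRing.scale /GRing.mul /= !(pc_mulE, pc_scaleE) mulrA.
Qed.

HB.instance Definition _ := GRing.Lmodule_isLalgebra.Build R Rinf pc_scaleAl.
HB.instance Definition _ := GRing.Lalgebra_isComAlgebra.Build R Rinf.

Lemma pc_addr e x y : \pi_Rinf (e, x) + \pi_Rinf (e, y) = \pi_Rinf (e, x + y).
Proof. exact: pc_addE. Qed.

Lemma pc_mulr e x y : \pi_Rinf (e, x) * \pi_Rinf (e, y) = \pi_Rinf (e, x * y).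
Proof. exact: pc_mulE. Qed.

Lemma pc_alg a : a%:A = \pi_Rinf (0%N, a).
Proof. by rewrite /GRing.scale /= pc_scaleE expn0 expr1 mulr1. Qed.

End PerfectClosure.

Section Tensor.
Variables (R : comNzRingType) (M N : lmodType R).

Local Notation free := {freeg (M * N)%type / R}.
Local Notation pure m n := (<< (m, n) >> : free).

(* The submodule of relations of the free module on M * N. *)
Inductive tensor_rel : free -> Prop :=
| TensorAddl m m' n : tensor_rel (pure (m + m') n - pure m n - pure m' n)
| TensorAddr m n n' : tensor_rel (pure m (n + n') - pure m n - pure m n')
| TensorScalel a m n : tensor_rel (pure (a *: m) n - a *: pure m n)
| TensorScaler a m n : tensor_rel (pure m (a *: n) - a *: pure m n)
| TensorZero : tensor_rel 0
| TensorLin a u v : tensor_rel u -> tensor_rel v -> tensor_rel (a *: u + v).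

Definition tensor_relb : {pred free} := fun u => `[< tensor_rel u >].

Local Lemma tensor_rel_closed : zmod_closed tensor_relb.
Proof.
split; first by apply/asboolP; apply: TensorZero.
move=> u v /asboolP hu /asboolP hv; apply/asboolP.
by rewrite addrC -scaleN1r; apply: TensorLin.
Qed.

HB.instance Definition _ := GRing.isZmodClosed.Build free tensor_relb tensor_rel_closed.

Definition tensor : Type := Quotient.quot tensor_relb.

HB.instance Definition _ := GRing.Zmodule.on tensor.

Local Notation cls u := (\pi_(Quotient.quot tensor_relb) u : tensor).

Definition tens (m : M) (n : N) : tensor := cls (pure m n).

Local Lemma tensor_eqP u v : cls u = cls v <-> tensor_rel (u - v).
Proof.
split=> [/eqP|h].
  by rewrite -Quotient.idealrBE => /asboolP.
by apply/eqP; rewrite -Quotient.idealrBE; apply/asboolP.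
Qed.

Definition tensor_scale (a : R) (t : tensor) : tensor :=
  cls (a *: repr (t : Quotient.quot tensor_relb)).

Local Lemma tensor_scale_pi a u : tensor_scale a (cls u) = cls (a *: u).
Proof.
apply/tensor_eqP; rewrite -scalerBr -[_ *: _]addr0.
apply: TensorLin TensorZero; apply/tensor_eqP; exact: reprK.
Qed.

Local Lemma tensor_pi_add u v : cls u + cls v = cls (u + v).
Proof. by rewrite [RHS](raddfD \pi_(Quotient.quot tensor_relb)). Qed.

Local Lemma tensor_scaleA a b t : tensor_scale a (tensor_scale b t) = tensor_scale (a * b) t.
Proof.
by elim/quotW: t => u; rewrite (tensor_scale_pi b) 2!tensor_scale_pi scalerA.
Qed.

Local Lemma tensor_scale1 : left_id 1 tensor_scale.
Proof. by elim/quotW => u; rewrite tensor_scale_pi scale1r. Qed.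

Local Lemma tensor_scaleDr : right_distributive tensor_scale +%R.
Proof.
move=> a; elim/quotW => u; elim/quotW => v.
by rewrite tensor_pi_add !tensor_scale_pi scalerDr tensor_pi_add.
Qed.

Local Lemma tensor_scaleDl t : {morph tensor_scale^~ t : a b / a + b}.
Proof.
by move=> a b; elim/quotW: t => u; rewrite !tensor_scale_pi scalerDl tensor_pi_add.
Qed.

HB.instance Definition _ := GRing.Zmodule_isLmodule.Build R tensor
  tensor_scaleA tensor_scale1 tensor_scaleDr tensor_scaleDl.

Lemma tensDl m m' n : tens (m + m') n = tens m n + tens m' n.
Proof.
rewrite /tens tensor_pi_add; apply/tensor_eqP; rewrite opprD addrA.
exact: TensorAddl.
Qed.

Lemma tensDr m n n' : tens m (n + n') = tens m n + tens m n'.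
Proof.
rewrite /tens tensor_pi_add; apply/tensor_eqP; rewrite opprD addrA.
exact: TensorAddr.
Qed.

Lemma tensZl a m n : tens (a *: m) n = a *: tens m n.
Proof.
rewrite /tens [RHS]tensor_scale_pi; apply/tensor_eqP; exact: TensorScalel.
Qed.

Lemma tensZr a m n : tens m (a *: n) = a *: tens m n.
Proof.
rewrite /tens [RHS]tensor_scale_pi; apply/tensor_eqP; exact: TensorScaler.
Qed.

Section Lift.
Variables (P : lmodType R) (beta : M -> N -> P).
Hypothesis betal : forall n, linear (beta^~ n).
Hypothesis betar : forall m, linear (beta m).

Let lift (u : free) : P := fglift (fun mn => beta mn.1 mn.2) u.

Local Lemma lift_linear : linear lift.
Proof.
have liftB : {morph lift : u v / u - v}.
  by move=> u v; apply: lift_is_additive.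
have lift0 : lift 0 = 0 by rewrite -(subrr 0) liftB subrr.
have liftN : {morph lift : u / - u} by move=> u; rewrite -sub0r liftB lift0 sub0r.
have liftD : {morph lift : u v / u + v}.
  by move=> u v; rewrite -{1}[v]opprK liftB liftN opprK.
have lift_sum (I : Type) (r : seq I) (F : I -> free) :
    lift (\sum_(i <- r) F i) = \sum_(i <- r) lift (F i).
  by apply: (big_morph lift liftD lift0).
move=> a u v; rewrite liftD; congr (_ + _).
have -> : a *: u = \sum_(x <- dom u) << a * coeff x u *g x >> by [].
rewrite -[u in RHS](freeg_sumE u) !lift_sum scaler_sumr.
by apply: eq_bigr => x _; rewrite /lift !liftU scalerA.
Qed.

Definition tensor_lift (t : tensor) : P := lift (repr (t : Quotient.quot tensor_relb)).

Local Lemma tensor_lift_pi u : tensor_lift (cls u) = lift u.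
Proof.
have lD := lift_linear.
have lB u1 v1 : lift (u1 - v1) = lift u1 - lift v1.
  by rewrite (addrC u1) -[- v1]scaleN1r lD scaleN1r addrC.
have l0 : lift 0 = 0 by rewrite -(subrr 0) lB subrr.
have lZ a u1 : lift (a *: u1) = a *: lift u1.
  by rewrite -[_ *: u1]addr0 lD l0 addr0.
have lU m n : lift (pure m n) = beta m n by rewrite /lift liftU scale1r.
have bDl m m' n : beta (m + m') n = beta m n + beta m' n.
  by have := betal n 1 m m'; rewrite /= !scale1r.
have bDr m n n' : beta m (n + n') = beta m n + beta m n'.
  by have := betar m 1 n n'; rewrite /= !scale1r.
have b0l n : beta 0 n = 0 by apply: (addrI (beta 0 n)); rewrite -bDl !addr0.
have b0r m : beta m 0 = 0 by apply: (addrI (beta m 0)); rewrite -bDr !addr0.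
have bZl a m n : beta (a *: m) n = a *: beta m n.
  by have := betal n a m 0; rewrite /= b0l !addr0.
have bZr a m n : beta m (a *: n) = a *: beta m n.
  by have := betar m a n 0; rewrite /= b0r !addr0.
have lrel w : tensor_rel w -> lift w = 0.
  elim=> {w} [m m' n|m n n'|a m n|a m n||a u1 v1 _ h1 _ h2].
  - by rewrite !lB !lU bDl -addrA -opprD subrr.
  - by rewrite !lB !lU bDr -addrA -opprD subrr.
  - by rewrite lB lZ !lU bZl subrr.
  - by rewrite lB lZ !lU bZr subrr.
  - exact: l0.
  - by rewrite lD h1 h2 scaler0 addr0.
apply/eqP; rewrite -subr_eq0 -lB; apply/eqP/lrel/tensor_eqP; exact: reprK.
Qed.

Lemma tensor_liftE m n : tensor_lift (tens m n) = beta m n.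
Proof. by rewrite tensor_lift_pi /lift liftU scale1r. Qed.

Lemma tensor_lift_linear : linear tensor_lift.
Proof.
move=> a; elim/quotW => u; elim/quotW => v.
by rewrite [a *: _]tensor_scale_pi tensor_pi_add !tensor_lift_pi lift_linear.
Qed.

End Lift.

Lemma tensor_ind (P : tensor -> Prop) :
    P 0 -> (forall a m n t, P t -> P (a *: tens m n + t)) -> forall t, P t.
Proof.
move=> P0 PD; elim/quotW => u; rewrite -(freeg_sumE u).
elim: (dom u) => [|[m n] r IH].
  rewrite big_nil; suff -> : cls 0 = 0 by [].
  by apply: (addrI (cls 0)); rewrite tensor_pi_add !addr0.
rewrite big_cons -tensor_pi_add.
have -> : << coeff (m, n) u *g (m, n) >> = coeff (m, n) u *: pure m n.
  apply/eqP/freeg_eqP => x.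
  by rewrite coeffZ !coeffU mul1r.
by rewrite -tensor_scale_pi; apply: PD.
Qed.

End Tensor.

Section TensorMap.
Variables (R : comNzRingType) (M N N' : lmodType R) (f : {linear N -> N'}).

Local Lemma tensor_map_linearl n : linear (fun m : M => tens m (f n)).
Proof. by move=> a m m'; rewrite tensDl tensZl. Qed.

Local Lemma tensor_map_linearr (m : M) : linear (fun n => tens m (f n)).
Proof. by move=> a n n'; rewrite linearP tensDr tensZr. Qed.

Definition tensor_map : tensor M N -> tensor M N' :=
  tensor_lift (fun m n => tens m (f n)).

HB.instance Definition _ := GRing.isLinear.Build R (tensor M N) (tensor M N') *:%R
  tensor_map (tensor_lift_linear tensor_map_linearl tensor_map_linearr).

Lemma tensor_mapE m n : tensor_map (tens m n) = tens m (f n).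
Proof. exact: tensor_liftE tensor_map_linearl tensor_map_linearr m n. Qed.

End TensorMap.
Arguments tensor_map {R} M {N N'} f.

Section FrobeniusCover.
Variable p : nat.

Definition module_finite (A B : comNzRingType) (g : A -> B) : Prop :=
  exists s : seq B, forall b, exists a : nat -> A, b = \sum_(i < size s) g (a i) * s`_i.

(* Surjectivity of the map Spec A -> Spec B induced by psi. *)
Definition spec_surjective (A B : comNzRingType) (psi : B -> A) : Prop :=
  forall Q : prime_idealr B, exists P : prime_idealr A,
    forall b, (b \in (Q : {pred B})) = (psi b \in (P : {pred A})).

(* The morphism Spec B -> Spec A given by g : A -> B is a finite Frobenius
   cover: finite morphisms are affine and of finite type, so that nothing is
   lost in working with rings. *)
Definition frobenius_cover (A B : comNzRingType) (g : {rmorphism A -> B}) : Prop :=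
  module_finite g /\
  exists (e : nat) (psi : {rmorphism B -> A}),
    (forall a, psi (g a) = a ^+ (p ^ e)) /\ spec_surjective psi.

Lemma frobenius_cover_id (A : comNzRingType) (g : {rmorphism A -> A}) :
  g =1 id -> frobenius_cover g.
Proof.
move=> gE; split.
  exists [:: 1] => b; exists (fun=> b).
  by rewrite big_ord_recl big_ord0 /= addr0 mulr1 gE.
exists 0%N, idfun; split=> [a|Q]; first by rewrite /= gE expr1.
by exists Q.
Qed.

Local Lemma span_mem (A B : comNzRingType) (g : {rmorphism A -> B}) (s : seq B) x :
  x \in s -> exists a : nat -> A, x = \sum_(i < size s) g (a i) * s`_i.
Proof.
move=> xs; exists (fun i => (i == index x s)%:R).
have lt_x : (index x s < size s)%N by rewrite index_mem.
rewrite (bigD1 (Ordinal lt_x)) //= eqxx rmorph1 mul1r nth_index // big1 ?addr0 //.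
by move=> i /negPf; rewrite -val_eqE /= => ->; rewrite rmorph0 mul0r.
Qed.

Local Lemma span_lin (A B : comNzRingType) (g : {rmorphism A -> B}) (s : seq B)
    (I : finType) (a : I -> A) (x : I -> B) :
  (forall i, exists c : nat -> A, x i = \sum_(j < size s) g (c j) * s`_j) ->
  exists c : nat -> A, \sum_i g (a i) * x i = \sum_(j < size s) g (c j) * s`_j.
Proof.
move=> /choice[c cP]; exists (fun j => \sum_i a i * c i j).
under eq_bigr do rewrite cP mulr_sumr.
rewrite exchange_big /=; apply: eq_bigr => j _.
rewrite rmorph_sum mulr_suml; apply: eq_bigr => i _.
by rewrite rmorphM mulrA.
Qed.

Lemma frobenius_cover_comp (A B C : comNzRingType) (g : {rmorphism A -> B})
    (h : {rmorphism B -> C}) (k : {rmorphism A -> C}) :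
  k =1 h \o g -> frobenius_cover g -> frobenius_cover h -> frobenius_cover k.
Proof.
move=> kE [[s sP] [e [psi [psiE psiS]]]] [[t tP] [e' [psi' [psi'E psi'S]]]]; split.
  exists [seq h x * y | x <- s, y <- t] => c.
  have [b ->] := tP c.
  have -> : \sum_(i < size t) h (b i) * t`_i = \sum_(i < size t) k 1 * (h (b i) * t`_i).
    by under [RHS]eq_bigr do rewrite rmorph1 mul1r.
  apply: (span_lin (fun=> 1)) => i; have [a ->] := sP (b i).
  have -> : h (\sum_(j < size s) g (a j) * s`_j) * t`_i =
            \sum_(j < size s) k (a j) * (h s`_j * t`_i).
    rewrite rmorph_sum mulr_suml; apply: eq_bigr => j _.
    by rewrite rmorphM mulrA kE.
  apply: (span_lin (fun j : 'I_(size s) => a j)) => j; apply: span_mem.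
  by apply/allpairsP; exists (s`_j, t`_i); rewrite !mem_nth.
exists (e' + e)%N, (psi \o psi'); split=> [a|Q].
  by rewrite /= kE /= psi'E rmorphXn psiE -exprM expnD mulnC.
have [P PE] := psi'S Q; have [P' P'E] := psiS P.
by exists P' => c; rewrite PE P'E.
Qed.

End FrobeniusCover.

Section Site.
Variables (R : comNzRingType) (p : nat).

(* The category underlying the Frobenius topology on Spec R, with arrows
   written on the ring side: an object is (the coordinate ring of) a finite
   Frobenius cover of Spec R, an arrow S -> T is a morphism Spec T -> Spec S
   over Spec R that is itself a finite Frobenius cover. *)
Record fcover := Fcover {
  fcover_ring :> comAlgType R;
  fcover_str : frobenius_cover p (in_alg fcover_ring) }.

Record fmor (S T : fcover) := Fmor {
  fmor_fun :> {lrmorphism S -> T};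
  fmor_cover : frobenius_cover p fmor_fun }.

Definition fmor_id (S : fcover) : fmor S S :=
  @Fmor S S idfun (@frobenius_cover_id p S idfun (frefl idfun)).

Definition fmor_comp (S T U : fcover) (g : fmor S T) (h : fmor T U) : fmor S U :=
  @Fmor S U (h \o g)
    (@frobenius_cover_comp p S T U g h (h \o g) (frefl _) (fmor_cover g) (fmor_cover h)).

Lemma frobenius_cover_base : frobenius_cover p (in_alg R^o : {rmorphism R -> R^o}).
Proof. by apply: (@frobenius_cover_id p R) => a; rewrite /= [_%:A]mulr1. Qed.

Definition fcover_base : fcover := Fcover frobenius_cover_base.

End Site.

(* Concrete categories, as value categories for presheaves; two arrows are
   compared through their underlying functions. *)
Record concreteCat := ConcreteCat {
  cobj :> Type;
  carrier : cobj -> Type;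
  chom : cobj -> cobj -> Type;
  capp : forall A B, chom A B -> carrier A -> carrier B;
  cid : forall A, chom A A;
  ccomp : forall A B C, chom A B -> chom B C -> chom A C;
  capp_id : forall A x, capp (cid A) x = x;
  capp_comp : forall A B C (f : chom A B) (g : chom B C) x,
    capp (ccomp f g) x = capp g (capp f x) }.

Definition ModCat (R : comNzRingType) : concreteCat :=
  @ConcreteCat (lmodType R) (fun A => A) (fun A B => {linear A -> B})
    (fun A B f => f) (fun A => idfun) (fun A B C f g => g \o f)
    (fun A x => erefl) (fun A B C f g x => erefl).

(* comPzRingType includes the zero ring *)
Definition CRingCat : concreteCat :=
  @ConcreteCat comPzRingType (fun A => A) (fun A B => {rmorphism A -> B})
    (fun A B f => f) (fun A => idfun) (fun A B C f g => g \o f)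
    (fun A x => erefl) (fun A B C f g x => erefl).

Section Sheaves.
Variables (R : comNzRingType) (p : nat) (C : concreteCat).
Local Notation site := (fcover R p).

(* Contravariant in schemes, hence covariant in rings. *)
Record presheaf := Presheaf {
  psh_obj :> site -> C;
  psh_map : forall S T : site, fmor S T -> chom (psh_obj S) (psh_obj T);
  psh_map_id : forall S (x : carrier (psh_obj S)), capp (psh_map (fmor_id S)) x = x;
  psh_map_comp : forall S T U (g : fmor S T) (h : fmor T U) (x : carrier (psh_obj S)),
    capp (psh_map (fmor_comp g h)) x = capp (psh_map h) (capp (psh_map g) x) }.

Definition sections (F : presheaf) (S : site) : Type := carrier (F S).
Definition restr (F : presheaf) (S T : site) (g : fmor S T) :
  sections F S -> sections F T := capp (psh_map F g).

Record pshmor (F G : presheaf) := Pshmor {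
  pm_obj : forall S, chom (F S) (G S);
  pm_nat : forall S T (g : fmor S T) (x : sections F S),
    capp (pm_obj T) (restr g x) = restr g (capp (pm_obj S) x) }.

Definition pm_app (F G : presheaf) (t : pshmor F G) (S : site) :
  sections F S -> sections G S := capp (pm_obj t S).

(* Every single arrow g : S -> T is a covering (of Spec S by Spec T).  A section
   x over T is a compatible family for it when its pullbacks along any two
   arrows equalized by g agree; the pair of projections from the fibre product
   Spec T x_(Spec S) Spec T is the universal such pair of arrows. *)
Definition is_sheaf (F : presheaf) : Prop :=
  forall (S T : site) (g : fmor S T) (x : sections F T),
    (forall (U : site) (a b : fmor T U), a \o g =1 b \o g -> restr a x = restr b x) ->
    exists! y : sections F S, restr g y = x.

Record sheafification (P : presheaf) := Sheafification {
  shf :> presheaf;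
  shf_is_sheaf : is_sheaf shf;
  shf_unit : pshmor P shf;
  shf_univ : forall (G : presheaf), is_sheaf G -> forall t : pshmor P G,
    exists u : pshmor shf G,
      (forall S x, pm_app u (pm_app shf_unit x) = pm_app t x :> sections G S) /\
      (forall v : pshmor shf G,
         (forall S x, pm_app v (pm_app shf_unit x) = pm_app t x :> sections G S) ->
         forall S (x : sections shf S), pm_app v x = pm_app u x) }.

End Sheaves.

Section Presheaves.
Variables (R : comNzRingType) (p : nat).
Local Notation site := (fcover R p).

Section Tensor.
Variable M : lmodType R.

Local Lemma tensor_map_id (S : site) (x : tensor M S) :
  tensor_map M (fmor_id S) x = x.
Proof.
elim/tensor_ind: x => [|a m n t IH]; first by rewrite linear0.
by rewrite linearP /= IH tensor_mapE.
Qed.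

Local Lemma tensor_map_comp (S T U : site) (g : fmor S T) (h : fmor T U) (x : tensor M S) :
  tensor_map M (fmor_comp g h) x = tensor_map M h (tensor_map M g x).
Proof.
elim/tensor_ind: x => [|a m n t IH]; first by rewrite !linear0.
by rewrite !linearP /= IH !tensor_mapE.
Qed.

(* Spec S |-> M (x)_R S; its sheafification is M_frob. *)
Definition tensor_presheaf : presheaf R p (ModCat R) :=
  @Presheaf R p (ModCat R) (fun S => tensor M S)
    (fun S T g => tensor_map M g : {linear tensor M S -> tensor M T})
    tensor_map_id tensor_map_comp.

End Tensor.

(* Spec S |-> S = R (x)_R S as a presheaf of rings. *)
Definition ring_presheaf : presheaf R p CRingCat :=
  @Presheaf R p CRingCat (fun S => S : comPzRingType)
    (fun S T g => g : {rmorphism S -> T})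
    (fun S x => erefl) (fun S T U g h x => erefl).

End Presheaves.

(* Main.v *)
From HB Require Import structures.
Require Import Defs.
From mathcomp Require Import all_boot all_algebra.
From mathcomp Require Import boolp classical_sets.

(* Every sheaf for the Frobenius topology is constant.  A covering [S -> T] can
   be followed by the covering killing the kernel of a power of Frobenius on
   [T], so restriction along any two parallel arrows agrees; the sheaf condition
   for a single arrow then says that its restriction is bijective.  Hence the
   sheafification is the constant presheaf on the colimit of the presheaf over
   the site.  Each cover [S] has a unique [R]-algebra map [S -> R^oo], and by
   freely adjoining [p^e]-th roots these maps are jointly surjective, even on
   pairs of elements; if [s] in [S] and [t] in [T] have the same image, then
   [s^(p^n) = c = t^(p^n)] for some [c] in [R], so both are images of the root in
   the cover [R[X] / (X^(p^n) - c)].  The colimit is thus [M (x) R^oo]. *)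

Set Implicit Arguments.
Unset Strict Implicit.
Unset Printing Implicit Defensive.

Import GRing.Theory.
Local Open Scope ring_scope.
Local Open Scope quotient_scope.

(** * Prime ideals and nilpotent elements *)

Lemma nilpotent_of_primes (A : comNzRingType) (x : A) :
  (forall P : prime_idealr A, x \in (P : {pred A})) -> exists n, x ^+ n = 0.
Proof.
move=> xP; apply: contrapT => xN.
(* An ideal maximal among those containing no power of [x] is prime and misses [x]. Membership of
   [0] is not imposed, so that the union of the empty chain qualifies in Zorn's lemma; it is
   recovered from maximality. *)
pose avoids (I : set A) := [/\ forall a b, I a -> I b -> I (a + b),
  forall r a, I a -> I (r * a) & forall n, ~ I (x ^+ n)].
have [F avF totF|I [[ID IM Ix] Imax]] := @Zorn_bigcup A avoids.
  split=> [a b [I FI Ia] [J FJ Jb]|r a [I FI Ia]|n [I FI In]].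
  - have [IJ|JI] := totF _ _ FI FJ.
      by exists J => //; have [D _ _] := avF _ FJ; apply: D => //; apply: IJ.
    by exists I => //; have [D _ _] := avF _ FI; apply: D => //; apply: JI.
  - by exists I => //; have [_ M _] := avF _ FI; apply: M.
  - by have [_ _ N] := avF _ FI; apply: (N n).
have max_of J : avoids J -> (forall a, I a -> J a) -> forall a, J a -> I a.
  move=> avJ IJ a Ja; apply: contrapT => nIa; apply: (Imax J) => //.
  by split=> // JI; apply/nIa/JI.
have I0 : I 0.
  apply: (max_of (fun a => I a \/ a = 0)); [split|by left|by right].
  - move=> a b [Ia|->] [Ib|->]; rewrite ?add0r ?addr0; by [left; apply: ID|left|right].
  - by move=> r a [Ia|->]; [left; apply: IM|right; rewrite mulr0].
  - by move=> n [/Ix//|xn0]; apply: xN; exists n.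
(* The ideal generated by [I] and [u] is strictly larger than [I], so it contains a power of [x]. *)
have ext u : ~ I u -> exists n r, I (x ^+ n - r * u).
  move=> nIu; apply: contrapT => none; apply: nIu.
  apply: (max_of (fun a => exists r, I (a - r * u))); first split.
  - move=> a b [r Ia] [s Ib]; exists (r + s).
    by rewrite mulrDl opprD addrACA; apply: ID.
  - by move=> r a [s Ia]; exists (r * s); rewrite -mulrA -mulrBr; apply: IM.
  - by move=> n [r Ir]; apply: none; exists n, r.
  - by move=> a Ia; exists 0; rewrite mul0r subr0.
  - by exists 1; rewrite mul1r subrr.
pose Ib : {pred A} := fun a => `[< I a >].
have idI : idealr_closed Ib.
  split; first exact/asboolP.
    by apply/asboolP; have := Ix 0%N; rewrite expr0.
  move=> a u v /asboolP Iu /asboolP Iv; apply/asboolP/ID => //; exact: IM.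
have prI : prime_idealr_closed Ib.
  move=> u v /asboolP Iuv; apply/orP; rewrite /in_mem /=.
  have [Iu|/ext[n [r Inr]]] := asboolP (I u); first by left; apply/asboolP.
  have [Iv|/ext[m [s Ims]]] := asboolP (I v); first by right; apply/asboolP.
  case: (Ix (n + m)%N).
  (* Modulo [I], [x ^+ n] is [r * u] and [x ^+ m] is [s * v], so their product is a multiple of
     [u * v], which lies in [I]. *)
  have -> : x ^+ (n + m) = x ^+ m * (x ^+ n - r * u) + (r * u * (x ^+ m - s * v) + r * s * (u * v)).
    rewrite exprD !mulrBr (mulrC (x ^+ n)) (mulrC (r * u) (x ^+ m)) mulrACA subrK subrK //.
  by apply: (ID _ _ (IM _ _ Inr) (ID _ _ (IM _ _ Ims) (IM _ _ Iuv))).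
pose P : prime_idealr A := HB.pack Ib (isIdealr.Build A Ib idI)
   (isPrimeIdealrClosed.Build A Ib prI).
have /asboolP := xP P.
by rewrite -[x]expr1; apply: Ix.
Qed.

(** * Powers of Frobenius and a characterization of finite Frobenius covers *)

Section FrobeniusPowers.
Variables (A : comNzRingType) (p : nat) (pA : p \in [pchar A]).

Lemma frobenius_pnat e : [pchar A].-nat (p ^ e)%N.
Proof. by rewrite (eq_pnat _ (pcharf_eq pA)) pnatX pnat_id // (pcharf_prime pA). Qed.

Lemma frobenius_expn_gt0 e : (0 < p ^ e)%N.
Proof. by rewrite expn_gt0 prime_gt0 // (pcharf_prime pA). Qed.

Lemma frobeniusD e (x y : A) : (x + y) ^+ (p ^ e) = x ^+ (p ^ e) + y ^+ (p ^ e).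
Proof. exact/exprDn_pchar/frobenius_pnat. Qed.

Lemma frobeniusB e (x y : A) : (x - y) ^+ (p ^ e) = x ^+ (p ^ e) - y ^+ (p ^ e).
Proof. by rewrite frobeniusD exprNn_pchar // frobenius_pnat. Qed.

Definition frobenius_iter (e : nat) (x : A) : A := x ^+ (p ^ e).

Lemma frobenius_iter_zmod e : zmod_morphism (frobenius_iter e).
Proof. exact: frobeniusB. Qed.

Lemma frobenius_iter_monoid e : monoid_morphism (frobenius_iter e).
Proof. by split=> [|x y]; rewrite /frobenius_iter ?expr1n ?exprMn. Qed.

Definition frobenius_rmorphism e : {rmorphism A -> A} :=
  HB.pack (frobenius_iter e)
    (GRing.isZmodMorphism.Build A A _ (frobenius_iter_zmod e))
    (GRing.isMonoidMorphism.Build A A _ (frobenius_iter_monoid e)).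

Lemma frobenius_expr_eq e n (x y : A) :
  (e <= n)%N -> x ^+ (p ^ e) = y ^+ (p ^ e) -> x ^+ (p ^ n) = y ^+ (p ^ n).
Proof. by move=> /subnKC <- xy; rewrite expnD !exprM xy. Qed.

Lemma frobenius_sum e (I : finType) (x : I -> A) :
  (\sum_i x i) ^+ (p ^ e) = \sum_i x i ^+ (p ^ e).
Proof. exact: (rmorph_sum (frobenius_rmorphism e)). Qed.

End FrobeniusPowers.

(* The kernel of the given map back to [A] is a nil ideal, of bounded exponent
   by finiteness, so that composing with a power of Frobenius gives an inverse
   up to Frobenius. *)
Lemma frobenius_coverP (p : nat) (A B : comNzRingType) (pA : p \in [pchar A])
    (g : {rmorphism A -> B}) :
  frobenius_cover p g <->
  module_finite g /\ exists (e : nat) (psi : {rmorphism B -> A}),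
    (forall a, psi (g a) = a ^+ (p ^ e)) /\ (forall b, g (psi b) = b ^+ (p ^ e)).
Proof.
have pB : p \in [pchar B] by apply: rmorph_pchar pA.
split=> -[fin [e [psi [psig h]]]]; split=> //; last first.
  exists e, psi; split=> // Q.
  (* The prime over [Q] is its contraction along [g]: it contains [psi b] iff [Q] contains
     [g (psi b) = b ^+ (p ^ e)], that is, iff [b] is in [Q]. *)
  pose P0 : {pred A} := fun a => g a \in (Q : {pred B}).
  have P0E a : (a \in P0) = (g a \in (Q : {pred B})) by [].
  have idP : idealr_closed P0.
    split=> [||a u v]; rewrite !P0E.
    - by rewrite rmorph0 idealr0.
    - by rewrite rmorph1 idealr1.
    - by move=> gu gv; rewrite rmorphD rmorphM rpredD ?idealMr.
  have prP : prime_idealr_closed P0.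
    by move=> u v; rewrite !P0E rmorphM prime_idealrM.
  pose P : prime_idealr A := HB.pack P0
    (isIdealr.Build A _ idP) (isPrimeIdealrClosed.Build A _ prP).
  exists P => b; rewrite [RHS]P0E h.
  have := frobenius_expn_gt0 pA e; case: (_ ^ e)%N => // n _.
  elim: n => [|n IHn]; first by rewrite expr1.
  by rewrite exprS prime_idealrM -IHn orbb.
case: (fin) => s sP.
(* The difference [g (psi b) - b ^+ (p ^ e)] is killed by [psi]. Every prime of [B] is a contraction
   along [psi], so the difference lies in all of them and is nilpotent. *)
have nil b : exists n, g (psi b) ^+ (p ^ n) = b ^+ (p ^ (e + n)).
  have [|n n0] := @nilpotent_of_primes B (g (psi b) - b ^+ (p ^ e)).
    move=> Q; have [P PE] := h Q.
    by rewrite PE rmorphB rmorphXn /= psig subrr idealr0.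
  exists n; apply/eqP; rewrite expnD exprM -subr_eq0 -(frobeniusB pB).
  have n_le : (n <= p ^ n)%N by rewrite ltnW // ltn_expl // prime_gt1 // (pcharf_prime pA).
  by rewrite -(subnKC n_le) exprD n0 mul0r.
have [n nP] := choice nil.
(* One exponent must serve all [b]. The maximum over the generators suffices, because Frobenius is
   additive and the identity already holds on the coefficients [g (a i)]. *)
pose N := \max_(i < size s) n (s`_i)%R.
have bound (i : 'I_(size s)) : g (psi s`_i) ^+ (p ^ N) = s`_i ^+ (p ^ (e + N)).
  rewrite expnD exprM; apply: (frobenius_expr_eq (e := n s`_i)).
    exact: (leq_bigmax (F := fun i : 'I_(size s) => n s`_i)).
  by rewrite nP expnD exprM.
pose psi' : {rmorphism B -> A} := frobenius_rmorphism pA N \o psi.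
exists (e + N)%N, psi'; split=> [a|b].
  by rewrite /= /frobenius_iter psig -exprM -expnD.
have -> : g (psi' b) = g (psi b) ^+ (p ^ N) by exact: rmorphXn.
have [a ->] := sP b.
rewrite !rmorph_sum !(frobenius_sum pB); apply: eq_bigr => i _.
by rewrite !rmorphM /= psig !exprMn bound rmorphXn -exprM -expnD.
Qed.

(** * Algebra structures along a ring morphism, and free adjunction of a root *)

Section AlgebraAlong.
Variables (R B : comNzRingType) (f : {rmorphism R -> B}).

(** The morphism is kept as a parameter of the type, so that the [R]-algebra structure it induces on
    [B] can be inferred. *)
Definition alg_along & {rmorphism R -> B} : Type := B.
Local Notation T := (alg_along f).

HB.instance Definition _ := GRing.ComNzRing.on T.

Let scale (r : R) (x : T) : T := f r * x.

Local Lemma alg_along_scaleA a b x : scale a (scale b x) = scale (a * b) x.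
Proof. by rewrite /scale rmorphM mulrA. Qed.

Local Lemma alg_along_scale1 : left_id 1 scale.
Proof. by move=> x; rewrite /scale rmorph1 mul1r. Qed.

Local Lemma alg_along_scaleDr : right_distributive scale +%R.
Proof. by move=> a x y; rewrite /scale mulrDr. Qed.

Local Lemma alg_along_scaleDl x : {morph scale^~ x : a b / a + b}.
Proof. by move=> a b; rewrite /scale rmorphD mulrDl. Qed.

HB.instance Definition _ := GRing.Zmodule_isLmodule.Build R T
  alg_along_scaleA alg_along_scale1 alg_along_scaleDr alg_along_scaleDl.

Local Lemma alg_along_scaleAl a (x y : T) : a *: (x * y) = (a *: x) * y.
Proof. exact: mulrA. Qed.

HB.instance Definition _ := GRing.Lmodule_isLalgebra.Build R T alg_along_scaleAl.
HB.instance Definition _ := GRing.Lalgebra_isComAlgebra.Build R T.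

Lemma alg_alongE r : r%:A = f r :> T.
Proof. exact: mulr1. Qed.

End AlgebraAlong.

(** The ring is [A[X] / (X^n - b)]. The polynomial is monic, so classes are represented by
    remainders of degree below [n], over an arbitrary [A]. *)
Lemma adjoin_root (A : comNzRingType) (b : A) (n : nat) : (0 < n)%N ->
  exists (B : comNzRingType) (g : {rmorphism A -> B}) (x : B),
  [/\ x ^+ n = g b,
      forall t : B, exists a : nat -> A, t = \sum_(i < n) g (a i) * x ^+ i &
      forall (U : comNzRingType) (f : {rmorphism A -> U}) (s : U), s ^+ n = f b ->
        exists k : {rmorphism B -> U}, k \o g =1 f /\ k x = s].
Proof.
move=> n0; pose h : {poly A} := 'X^n - b%:P.
have sh : size h = n.+1 by rewrite size_XnsubC.
have mh : h \is monic by rewrite monicXnsubC.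
(* The quotient type divides by [mk_monic h], which falls back to ['X] unless its argument is monic
   and not constant; [0 < n] excludes this. *)
have hE : mk_monic h = h by rewrite /mk_monic sh mh ltnS n0.
exists {poly %/ h}, (qpolyC h), (in_qpoly h 'X).
have XE i : in_qpoly h 'X ^+ i = in_qpoly h 'X^i by rewrite [RHS]rmorphXn.
have CE a : in_qpoly h a%:P = qpolyC h a.
  apply: val_inj; rewrite /= hE Pdiv.Ring.rmodp_small // size_polyC.
  by rewrite sh; case: (a != 0).
have hh : in_qpoly h h = 0.
  by apply: val_inj; rewrite /= hE Pdiv.RingMonic.rmodpp.
split.
- rewrite XE /= -CE; have -> : 'X^n = h + b%:P by rewrite subrK.
  by rewrite in_qpolyD hh add0r.
- move=> t; exists (fun i => (t : {poly A})`_i).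
  have st : (size (t : {poly A}) <= n)%N.
    have smh : size (mk_monic h) = n.+1 by rewrite hE.
    by rewrite -ltnS -smh size_mk_monic.
  have {1}-> : t = in_qpoly h t.
    by apply: val_inj; symmetry; apply: in_qpoly_small; apply: size_mk_monic.
  have tE : t = \sum_(i < n) ((t : {poly A})`_i)%:P * 'X^i :> {poly A}.
    rewrite -[LHS]coefK poly_def [LHS](big_ord_widen n (fun i => (t : {poly A})`_i *: 'X^i) st).
    rewrite big_mkcond; apply: eq_bigr => i _; rewrite mul_polyC.
    by case: ifP => // /negbT; rewrite -leqNgt => /(nth_default 0) ->; rewrite scale0r.
  rewrite [in LHS]tE rmorph_sum; apply: eq_bigr => i _.
  by rewrite rmorphM /= CE -XE.
- move=> U f s sE.
  have cfs : commr_rmorph f s by move=> a; apply: mulrC.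
  pose k (t : {poly %/ h}) : U := horner_morph cfs t.
  (* Evaluation at [s] does not change under reduction modulo [h], as [h] evaluates to
     [s ^+ n - f b = 0]. *)
  have kmod q : horner_morph cfs (Pdiv.Ring.rmodp q (mk_monic h)) = horner_morph cfs q.
    rewrite hE [in RHS](Pdiv.RingMonic.rdivp_eq mh q) rmorphD rmorphM /=.
    suff -> : horner_morph cfs h = 0 by rewrite mulr0 add0r.
    by rewrite rmorphB rmorphXn /= horner_morphX horner_morphC sE subrr.
  have kB : zmod_morphism k by move=> u v; rewrite /k -rmorphB.
  have kM : monoid_morphism k.
    split; first by rewrite /k rmorph1.
    by move=> u v; rewrite /k poly_of_qpolyM kmod rmorphM.
  exists (HB.pack k (GRing.isZmodMorphism.Build _ _ _ kB)
    (GRing.isMonoidMorphism.Build _ _ _ kM) : {rmorphism {poly %/ h} -> U}).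
  split=> [a|]; rewrite /= /k; first by rewrite horner_morphC.
  by rewrite /in_qpoly /= kmod horner_morphX.
Qed.

(** * Construction of objects and arrows of the Frobenius site *)

Section Covers.
Variables (R : comNzRingType) (p : nat) (pR : p \in [pchar R]).
Local Notation site := (fcover R p).

Lemma pchar_alg (S : comAlgType R) : p \in [pchar S].
Proof. exact: (rmorph_pchar (in_alg S)). Qed.

(** The tool for comparing maps out of [S]: a power of Frobenius carries all of [S] into the image
    of [R], where any two algebra maps agree. *)
Lemma fcover_retract (S : site) : exists (e : nat) (psi : {rmorphism S -> R}),
  (forall a, psi a%:A = a ^+ (p ^ e)) /\ (forall s, (psi s)%:A = s ^+ (p ^ e)).
Proof. by have /(frobenius_coverP pR)[] := fcover_str S. Qed.

(** Arrows of the site thus come from arbitrary algebra maps. The inverse up to Frobenius is the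
    retraction of [T] to [R] followed by the structure map of [S]. *)
Lemma alg_hom_cover (S T : site) (h : {lrmorphism S -> T}) : frobenius_cover p h.
Proof.
apply/(frobenius_coverP (pchar_alg S)); split.
  have [[s sP] _] := fcover_str T; exists s => b; have [a ->] := sP b.
  exists (fun i => (a i)%:A); apply: eq_bigr => i _.
  by congr (_ * _); rewrite -[LHS](rmorph_alg h).
have [d [phi [phi_alg phiK]]] := fcover_retract S.
have [e [psi [psi_alg psiK]]] := fcover_retract T.
(* As [h] may fail to be injective, [psi (h s)] is not computable from [psiK] alone. Its [p ^ d]-th
   power is, because [s ^+ (p ^ d)] comes from [R]. *)
exists (d + e)%N, (in_alg S \o (frobenius_rmorphism pR d \o psi)).
split=> [s|t] /=; rewrite /frobenius_iter.
  rewrite -!rmorphXn /= -phiK rmorph_alg psi_alg.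
  by rewrite -in_algE rmorphXn /= phiK expnD exprM.
by rewrite rmorph_alg -in_algE rmorphXn /= psiK -exprM -expnD addnC.
Qed.

Definition fmor_of (S T : site) (h : {lrmorphism S -> T}) : fmor S T :=
  Fmor (alg_hom_cover h).

(** The restriction maps of a presheaf depend on the arrow as a record, so a genuine equality is
    needed; proof irrelevance supplies it. *)
Lemma fmor_ext (S T : site) (g h : fmor S T) : g =1 h -> g = h.
Proof.
case: g h => [[g [[a1] [a2] [a3]]] gP] [[h [[b1] [b2] [b3]]] hP] /= /funext gh.
rewrite /= in gh; subst h.
have ? := Prop_irrelevance a1 b1; have ? := Prop_irrelevance a2 b2.
have ? := Prop_irrelevance a3 b3; subst b1 b2 b3.
by congr Fmor; apply: Prop_irrelevance.
Qed.

Section Over.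
Variables (S : site) (B : comNzRingType) (g : {rmorphism S -> B}).
Hypothesis gP : frobenius_cover p g.

Local Notation BR := (alg_along (g \o in_alg S)).

Local Lemma fcover_over_str : frobenius_cover p (in_alg BR).
Proof.
apply: (frobenius_cover_comp (h := g : {rmorphism S -> BR}) _ (fcover_str S) gP).
by move=> r; rewrite /= [LHS]alg_alongE.
Qed.

Definition fcover_over : site := Fcover fcover_over_str.

Local Lemma fmor_over_scalable : scalable (g : S -> fcover_over).
Proof.
move=> r s; rewrite -[r *: s]mul1r -scalerAr scalerAl rmorphM.
by [].
Qed.

Definition fmor_over : fmor S fcover_over :=
  fmor_of (HB.pack (g : S -> fcover_over)
    (GRing.RMorphism.class (g : {rmorphism S -> fcover_over}))
    (GRing.isScalable.Build R S fcover_over *:%R g fmor_over_scalable)).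

Lemma fmor_overE s : fmor_over s = g s :> B.
Proof. by []. Qed.

End Over.

(** The [e]-th power of Frobenius on [S] factors through the quotient by its kernel, and this factor
    [psi] is the inverse up to Frobenius that makes the quotient map a cover. *)
Lemma kill_frobenius_kernel (S : site) (e : nat) :
  exists (T : site) (h : fmor S T),
    forall x y : S, x ^+ (p ^ e) = y ^+ (p ^ e) -> h x = h y.
Proof.
have pS := pchar_alg S.
pose I : {pred S} := fun x => x ^+ (p ^ e) == 0.
have IE x : (x \in I) = (x ^+ (p ^ e) == 0) by [].
have q0 := frobenius_expn_gt0 pS e.
have idI : idealr_closed I.
  split; rewrite ?IE.
  - by rewrite expr0n eqn0Ngt q0.
  - by rewrite expr1n oner_eq0.
  - move=> a u v; rewrite !IE => /eqP u0 /eqP v0.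
    by rewrite (frobeniusD pS) exprMn u0 v0 mulr0 addr0.
pose J : idealr S := HB.pack I (isIdealr.Build S I idI).
pose B : comNzRingType := {ideal_quot J}.
pose g : {rmorphism S -> B} := \pi_{ideal_quot J}.
have gE x y : g x = g y <-> x ^+ (p ^ e) = y ^+ (p ^ e).
  split=> [/eqP|xy].
    by rewrite -Quotient.idealrBE IE (frobeniusB pS) subr_eq0 => /eqP.
  by apply/eqP; rewrite -Quotient.idealrBE IE (frobeniusB pS) subr_eq0 xy.
pose psi (b : B) : S := repr b ^+ (p ^ e).
have psig s : psi (g s) = s ^+ (p ^ e) by apply/gE; apply: reprK.
have gsurj b : exists s, b = g s by exists (repr b); rewrite [RHS]reprK.
have psiB : zmod_morphism psi.
  move=> u v; have [x ->] := gsurj u; have [y ->] := gsurj v.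
  by rewrite -rmorphB !psig (frobeniusB pS).
have psiM : monoid_morphism psi.
  split=> [|u v]; first by rewrite -(rmorph1 g) psig expr1n.
  have [x ->] := gsurj u; have [y ->] := gsurj v.
  by rewrite -rmorphM !psig exprMn.
have gP : frobenius_cover p g.
  apply/(frobenius_coverP pS); split.
    exists [:: 1] => b; have [s ->] := gsurj b; exists (fun=> s).
    by rewrite big_ord_recl big_ord0 addr0 mulr1.
  exists e, (HB.pack psi (GRing.isZmodMorphism.Build _ _ _ psiB)
    (GRing.isMonoidMorphism.Build _ _ _ psiM) : {rmorphism B -> S}); split=> //= b.
  by have [s ->] := gsurj b; rewrite psig rmorphXn.
by exists (fcover_over gP), (fmor_over gP) => x y; rewrite !fmor_overE => /gE.
Qed.

(** The universal property yields the inverse up to Frobenius as well: extend the [e]-th power of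
    Frobenius on [S] by sending the root [x] to [b], whose image in the new ring is
    [x ^+ (p ^ e)]. *)
Lemma adjoin_frobenius_root (S : site) (b : S) (e : nat) :
  exists (T : site) (h : fmor S T) (x : T), x ^+ (p ^ e) = h b /\
    forall (U : site) (f : {lrmorphism S -> U}) (s : U), s ^+ (p ^ e) = f b ->
      exists k : fmor T U, k x = s.
Proof.
have pS := pchar_alg S.
have q0 := frobenius_expn_gt0 pS e.
have [B [g [x [xE spanB univB]]]] := adjoin_root b q0.
have pB : p \in [pchar B] by apply: rmorph_pchar pS.
have gP : frobenius_cover p g.
  apply/(frobenius_coverP pS); split.
    exists [seq x ^+ i | i <- iota 0 (p ^ e)] => t; have [a ->] := spanB t.
    exists a; rewrite size_map size_iota; apply: eq_bigr => i _.
    by rewrite (nth_map 0%N) ?size_iota // nth_iota.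
  have [psi [psig psix]] := univB S (frobenius_rmorphism pS e) b erefl.
  exists e, psi; split=> // t; have [a ->] := spanB t.
  rewrite !rmorph_sum (frobenius_sum pB); apply: eq_bigr => i _.
  rewrite !rmorphM !rmorphXn /= psix -xE [psi (g _)]psig.
  by rewrite exprMn -!rmorphXn exprAC.
exists (fcover_over gP), (fmor_over gP), x; split=> // U f s sE.
have [k [kf ks]] := univB U f s sE.
have kZ : scalable (k : fcover_over gP -> U).
  move=> r t; rewrite -[X in k X]/(g r%:A * t) rmorphM.
  by rewrite [k (g _)]kf [X in X * _](rmorph_alg f) mulr_algl.
by exists (fmor_of (HB.pack (k : fcover_over gP -> U)
    (GRing.RMorphism.class (k : {rmorphism fcover_over gP -> U}))
    (GRing.isScalable.Build R (fcover_over gP) U *:%R k kZ))).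
Qed.

End Covers.

(** * Maps from covers to the perfect closure *)

Section PerfectClosureMaps.
Variables (R : comNzRingType) (p : nat) (pR : p \in [pchar R]).
Local Notation site := (fcover R p).
Local Notation Rinf := (perfect_closure pR).

Lemma pc_exprn e (x : R) n : (\pi_Rinf (e, x)) ^+ n = \pi_Rinf (e, x ^+ n).
Proof.
elim: n => [|n IHn]; first by rewrite -[LHS]scale1r pc_alg -(Defs.pc_stepn pR 0 e) expr1n.
by rewrite !exprS IHn pc_mulr.
Qed.

Lemma pc_expr_root e (x : R) : (\pi_Rinf (e, x)) ^+ (p ^ e) = x%:A.
Proof. by rewrite pc_exprn pc_alg -(Defs.pc_stepn pR 0 e). Qed.

Lemma pc_algP (x y : R) :
  x%:A = y%:A :> Rinf <-> exists n, x ^+ (p ^ n) = y ^+ (p ^ n).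
Proof.
rewrite !pc_alg; split=> [/eqP/Defs.pc_eqP[a [b /= [+ xy]]]|[n xy]].
  by rewrite !add0n => ab; exists a; rewrite xy ab.
by apply/eqP/Defs.pc_eqP; exists n, n.
Qed.

Lemma pc_expr_inj n : injective (fun u : Rinf => u ^+ (p ^ n)).
Proof.
move=> u v /=; have [e [x [y [-> ->]]]] := Defs.pc_ex2 u v.
rewrite !pc_exprn => /eqP/Defs.pc_eqP[a [b /= [/addnI <- xy]]].
apply/eqP/Defs.pc_eqP; exists (n + a)%N, (n + a)%N; split=> //=.
by rewrite expnD !exprM.
Qed.

(** The image of [s] has to be the [p ^ e]-th root of [psi s], which is the class of
    [(e, psi s)]. *)
Lemma pc_map_exists (S : site) : exists kappa : {lrmorphism S -> Rinf}, True.
Proof.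
have [e [psi [psi_alg _]]] := fcover_retract pR S.
pose k (s : S) : Rinf := \pi_Rinf (e, psi s).
have kB : zmod_morphism k.
  move=> s t; apply: (addIr (k t)).
  by rewrite subrK /k pc_addr -rmorphD subrK.
have kM : monoid_morphism k.
  split=> [|s t]; last by rewrite /k pc_mulr rmorphM.
  by rewrite /k rmorph1 -[RHS]scale1r pc_alg -(Defs.pc_stepn pR 0 e) expr1n.
have kZ : scalable k.
  move=> a s; rewrite -[a *: s]mulr_algl kM.2 -[RHS]mulr_algl.
  by rewrite {1}/k psi_alg pc_alg -(Defs.pc_stepn pR 0 e).
by exists (HB.pack k (GRing.isZmodMorphism.Build _ _ _ kB)
  (GRing.isMonoidMorphism.Build _ _ _ kM) (GRing.isScalable.Build _ _ _ _ k kZ)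
  : {lrmorphism S -> Rinf}).
Qed.

Definition pc_map (S : site) : {lrmorphism S -> Rinf} := sval (cid (pc_map_exists S)).

(** Raising to the power [p ^ (d + e)] moves both elements into the image of [R]. The resulting
    elements of [R] agree in [Rinf], hence agree in [R] after a further power of Frobenius. *)
Lemma pc_map_eq (S T : site) (s : S) (t : T)
    (f : {lrmorphism S -> Rinf}) (g : {lrmorphism T -> Rinf}) : f s = g t ->
  exists n c, s ^+ (p ^ n) = c%:A /\ t ^+ (p ^ n) = c%:A.
Proof.
move=> fg; have [d [phi [_ phiK]]] := fcover_retract pR S.
have [e [psi [_ psiK]]] := fcover_retract pR T.
have sE : s ^+ (p ^ (d + e)) = (phi s ^+ (p ^ e))%:A.
  by rewrite expnD exprM -phiK exprZn expr1n.
have tE : t ^+ (p ^ (d + e)) = (psi t ^+ (p ^ d))%:A.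
  by rewrite addnC expnD exprM -psiK exprZn expr1n.
have /pc_algP[n phi_psi] : (phi s ^+ (p ^ e))%:A = (psi t ^+ (p ^ d))%:A :> Rinf.
  by rewrite -(rmorph_alg f) -(rmorph_alg g) -sE -tE !rmorphXn /= fg.
exists (d + e + n)%N, ((phi s ^+ (p ^ e)) ^+ (p ^ n)); split.
  by rewrite expnD exprM sE exprZn expr1n.
by rewrite phi_psi expnD exprM tE exprZn expr1n.
Qed.

(** A power [s ^+ (p ^ e)] comes from [R], and [p ^ e]-th roots in [Rinf] are unique. *)
Lemma pc_map_unique (S : site) (f g : {lrmorphism S -> Rinf}) : f =1 g.
Proof.
move=> s; have [e [psi [_ psiK]]] := fcover_retract pR S.
by apply: (@pc_expr_inj e); rewrite /= -!rmorphXn /= -psiK !rmorph_alg.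
Qed.

Lemma pc_map_nat (S T : site) (h : fmor S T) s : pc_map T (h s) = pc_map S s.
Proof. exact: (pc_map_unique (pc_map T \o h) (pc_map S)). Qed.

Lemma pc_map_root (S : site) (r : Rinf) :
  exists (T : site) (h : fmor S T) (t : T), pc_map T t = r.
Proof.
elim/quotW: r => -[e a].
have [T [h [x [xE _]]]] := adjoin_frobenius_root pR (a%:A : S) e.
exists T, h, x; apply: (@pc_expr_inj e).
by rewrite /= pc_expr_root -rmorphXn /= xE !rmorph_alg.
Qed.

Lemma pc_map_cover (r : Rinf) : exists (S : site) (s : S), pc_map S s = r.
Proof. by have [S [_ [s <-]]] := pc_map_root (fcover_base R p) r; exists S, s. Qed.

(** Additivity or multiplicativity of a map on [Rinf] can then be checked inside a single cover. *)
Lemma pc_map_cover2 (r1 r2 : Rinf) :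
  exists (S : site) (s1 s2 : S), pc_map S s1 = r1 /\ pc_map S s2 = r2.
Proof.
have [S [s1 <-]] := pc_map_cover r1; have [T [h [t <-]]] := pc_map_root S r2.
by exists T, (h s1), t; rewrite pc_map_nat.
Qed.

Lemma in_alg_scalable (S : comAlgType R) : scalable (in_alg S : R^o -> S).
Proof. by move=> a b; rewrite /= scalerA. Qed.

Definition fmor_str (S : site) : fmor (fcover_base R p) S :=
  fmor_of pR (HB.pack (in_alg S : R^o -> S)
    (GRing.RMorphism.class (in_alg S : {rmorphism R^o -> S}))
    (GRing.isScalable.Build R R^o S *:%R _ (@in_alg_scalable S))
    : {lrmorphism fcover_base R p -> S}).

Section Factor.
Variables (W : Type) (phi : forall S : site, S -> W).
Hypothesis phi_nat : forall (S T : site) (h : fmor S T) s, phi (h s) = phi s.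

(* Both elements are images of the root of [X ^ (p ^ n) = c] freely adjoined
   to [R]. *)
Lemma pc_map_factor_eq (S T : site) (s : S) (t : T) :
  pc_map S s = pc_map T t -> phi s = phi t.
Proof.
move=> /pc_map_eq[n [c [sE tE]]].
have [U [_ [x [_ univ]]]] := adjoin_frobenius_root pR (c : fcover_base R p) n.
have [k <-] := univ S (fmor_str S) s sE; have [l <-] := univ T (fmor_str T) t tE.
by rewrite !phi_nat.
Qed.

(** With joint surjectivity, this makes [Rinf] the colimit of the covers in sets. *)
Lemma pc_map_factor : exists u : Rinf -> W, forall (S : site) s, u (pc_map S s) = phi s.
Proof.
have /choice[u uP] (r : Rinf) : exists w, forall (S : site) s, pc_map S s = r -> w = phi s.
  by have [T [t <-]] := pc_map_cover r; exists (phi t) => S s /pc_map_factor_eq ->.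
by exists u => S s; apply: uP.
Qed.

End Factor.

End PerfectClosureMaps.

(** * Bijectivity of the restriction maps of a sheaf *)

Section SheafConstant.
Variables (R : comNzRingType) (p : nat) (pR : p \in [pchar R]).
Variables (C : concreteCat) (G : presheaf R p C).
Hypothesis Gsheaf : is_sheaf G.
Local Notation site := (fcover R p).

Lemma restr_comp (S T U : site) (g : fmor S T) (h : fmor T U) (x : sections G S) :
  restr (fmor_comp g h) x = restr h (restr g x).
Proof. exact: psh_map_comp. Qed.

(** The section [restr g y] is compatible with [y] as a gluing, and gluings are unique. *)
Lemma restr_inj (S T : site) (g : fmor S T) : injective (@restr _ _ _ G _ _ g).
Proof.
move=> y z yz; have [|w [_ wP]] := Gsheaf (g := g) (x := restr g y).
  move=> U a b ab; rewrite -!restr_comp; congr (restr _ y); exact: fmor_ext.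
by rewrite -(wP y) // -(wP z).
Qed.

(* Two arrows [S -> T] agree after a power of Frobenius, hence after killing the
   kernel of that power in [T], which is again a covering. *)
Lemma restr_parallel (S T : site) (g h : fmor S T) (x : sections G S) :
  restr g x = restr h x.
Proof.
have [e [psi [_ psiK]]] := fcover_retract pR S.
have [U [k kP]] := kill_frobenius_kernel pR T e.
apply: (restr_inj (g := k)); rewrite -!restr_comp; congr (restr _ x).
apply: fmor_ext => s /=; apply: kP.
by rewrite -!rmorphXn /= -psiK !rmorph_alg.
Qed.

Lemma restr_surj (S T : site) (g : fmor S T) (y : sections G T) :
  exists x, restr g x = y.
Proof.
have [|x [xP _]] := Gsheaf (g := g) (x := y); last by exists x.
by move=> U a b _; apply: restr_parallel.
Qed.

Lemma restr_str (S T : site) (g : fmor S T) (x : sections G (fcover_base R p)) :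
  restr g (restr (fmor_str pR S) x) = restr (fmor_str pR T) x.
Proof. by rewrite -restr_comp; apply: restr_parallel. Qed.

Lemma restr_str_inv (S : site) : exists rho : sections G S -> sections G (fcover_base R p),
  cancel rho (restr (fmor_str pR S)) /\ cancel (restr (fmor_str pR S)) rho.
Proof.
have /choice[rho rhoK] := restr_surj (fmor_str pR S).
by exists rho; split=> // x; apply: (restr_inj (g := fmor_str pR S)).
Qed.

End SheafConstant.

(** * Constant sheaves and the universal property of sheafification *)

Section Sheafification.
Variables (R : comNzRingType) (p : nat) (C : concreteCat).
Local Notation site := (fcover R p).

Definition constant_presheaf (c : C) : presheaf R p C :=
  @Presheaf R p C (fun=> c) (fun _ _ _ => Defs.cid c)
    (fun S x => capp_id x)
    (fun S T U g h x => esym (capp_id (capp (Defs.cid c) x))).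

Lemma restr_constant (c : C) (S T : site) (g : fmor S T)
    (x : sections (constant_presheaf c) S) : restr g x = x.
Proof. exact: capp_id. Qed.

Lemma constant_is_sheaf (c : C) : is_sheaf (constant_presheaf c).
Proof.
move=> S T g x _; exists x; split; first exact: restr_constant.
by move=> y <-; rewrite restr_constant.
Qed.

Lemma pshmor_id_nat (F : presheaf R p C) (S T : site) (g : fmor S T) (x : sections F S) :
  capp (Defs.cid (F T)) (restr g x) = restr g (capp (Defs.cid (F S)) x).
Proof. by rewrite !capp_id. Qed.

Definition pshmor_id (F : presheaf R p C) : pshmor F F := Pshmor (@pshmor_id_nat F).

Lemma pshmor_comp_nat (F G H : presheaf R p C) (u : pshmor F G) (v : pshmor G H)
    (S T : site) (g : fmor S T) (x : sections F S) :
  capp (ccomp (pm_obj u T) (pm_obj v T)) (restr g x) =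
  restr g (capp (ccomp (pm_obj u S) (pm_obj v S)) x).
Proof. by rewrite !capp_comp !pm_nat. Qed.

Definition pshmor_comp (F G H : presheaf R p C) (u : pshmor F G) (v : pshmor G H) :
  pshmor F H := Pshmor (pshmor_comp_nat u v).

Lemma pshmor_compE (F G H : presheaf R p C) (u : pshmor F G) (v : pshmor G H) (S : site)
    (x : sections F S) : pm_app (pshmor_comp u v) x = pm_app v (pm_app u x).
Proof. exact: capp_comp. Qed.

Lemma sheafification_endo (P : presheaf R p C) (F : sheafification P) (u : pshmor F F) :
  (forall S x, pm_app u (pm_app (shf_unit F) x) = pm_app (shf_unit F) x :> sections F S) ->
  forall S (x : sections F S), pm_app u x = x.
Proof.
move=> uP S x; have [w [_ wP]] := shf_univ F (@shf_is_sheaf _ _ _ _ F) (shf_unit F).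
rewrite (wP u) // -(wP (pshmor_id F)); first exact: capp_id.
by move=> T y; apply: capp_id.
Qed.

Lemma sheafification_iso (P : presheaf R p C) (F G : sheafification P) :
  exists u : pshmor F G,
    (forall S x, pm_app u (pm_app (shf_unit F) x) = pm_app (shf_unit G) x :> sections G S) /\
    forall S, bijective (@pm_app _ _ _ _ _ u S).
Proof.
have [u [uP _]] := shf_univ F (@shf_is_sheaf _ _ _ _ G) (shf_unit G).
have [v [vP _]] := shf_univ G (@shf_is_sheaf _ _ _ _ F) (shf_unit F).
exists u; split=> // S; exists (@pm_app _ _ _ _ _ v S) => x; rewrite -pshmor_compE.
  by apply: sheafification_endo => T y; rewrite pshmor_compE uP vP.
by apply: sheafification_endo => T y; rewrite pshmor_compE vP uP.
Qed.

Variable pR : p \in [pchar R].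
Local Notation X := (fcover_base R p).

(** Inverting the restrictions of [G] from the base turns a morphism to a sheaf into a cocone with
    vertex [G X]. *)
Lemma pshmor_descend (P G : presheaf R p C) (Gsheaf : is_sheaf G) (t : pshmor P G) :
  exists phi : forall S : site, sections P S -> sections G X,
  [/\ forall S x, restr (fmor_str pR S) (phi S x) = pm_app t x
    & forall (S T : site) (g : fmor S T) x, phi T (restr g x) = phi S x].
Proof.
pose rho S := sval (cid (restr_str_inv pR Gsheaf S)).
have rhoK S : cancel (rho S) (restr (fmor_str pR S)).
  by rewrite /rho; case: cid => ? [].
exists (fun S x => rho S (pm_app t x)); split=> [S x|S T g x]; first exact: rhoK.
apply: (restr_inj Gsheaf (g := fmor_str pR T)).
by rewrite rhoK -(restr_str pR Gsheaf g) rhoK [LHS]pm_nat.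
Qed.

Lemma pshmor_constant_nat (c : C) (G : presheaf R p C) (Gsheaf : is_sheaf G)
    (w : chom c (G X)) (S T : site) (g : fmor S T) (x : sections (constant_presheaf c) S) :
  capp (ccomp w (psh_map G (fmor_str pR T))) (restr g x) =
  restr g (capp (ccomp w (psh_map G (fmor_str pR S))) x).
Proof.
by rewrite restr_constant !capp_comp; symmetry; apply: (restr_str pR Gsheaf).
Qed.

(** This reduces sheafification to [c] being a colimit of [P]. The cocone [phi] consists of bare
    functions; its relation to [t], with injectivity of restriction, is what later shows that it
    respects the algebraic structure. *)
Lemma constant_univ (P : presheaf R p C) (c : C)
    (eta : pshmor P (constant_presheaf c)) :
  (forall (G : presheaf R p C) (phi : forall S : site, sections P S -> sections G X),
     is_sheaf G ->
     forall t : pshmor P G,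
     (forall S x, restr (fmor_str pR S) (phi S x) = pm_app t x) ->
     (forall (S T : site) (g : fmor S T) x, phi T (restr g x) = phi S x) ->
     exists w : chom c (G X),
       (forall S x, capp w (pm_app eta x) = phi S x) /\
       forall w' : chom c (G X), (forall S x, capp w' (pm_app eta x) = phi S x) ->
         capp w' =1 capp w) ->
  forall G : presheaf R p C, is_sheaf G -> forall t : pshmor P G,
    exists u : pshmor (constant_presheaf c) G,
      (forall S x, pm_app u (pm_app eta x) = pm_app t x :> sections G S) /\
      (forall v : pshmor (constant_presheaf c) G,
         (forall S x, pm_app v (pm_app eta x) = pm_app t x :> sections G S) ->
         forall S (x : sections (constant_presheaf c) S), pm_app v x = pm_app u x).
Proof.
move=> univ G Gsheaf t; have [phi [phiP phi_nat]] := pshmor_descend Gsheaf t.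
have [w [wP w_unique]] := univ G phi Gsheaf t phiP phi_nat.
exists (Pshmor (pshmor_constant_nat Gsheaf w)); split=> [S x|v vP S x].
  by rewrite -phiP -wP; apply: capp_comp.
(* By naturality along the structure arrow, [v] at [S] is determined by its component at the
   base. *)
rewrite [RHS]capp_comp -(w_unique (pm_obj v X)).
  rewrite -[LHS]/(pm_app v (x : sections (constant_presheaf c) S)).
  by rewrite -(restr_constant (fmor_str pR S) x) [LHS]pm_nat restr_constant.
move=> T y; apply: (restr_inj Gsheaf (g := fmor_str pR T)).
have <- := pm_nat v (fmor_str pR T) (pm_app eta y : sections (constant_presheaf c) X).
by rewrite phiP -vP restr_constant.
Qed.

End Sheafification.

(** * The constant sheaf on [M (x) Rinf] as module sheafification *)

Section ModuleSheafification.
Variables (R : comNzRingType) (p : nat) (pR : p \in [pchar R]) (M : lmodType R).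
Local Notation site := (fcover R p).
Local Notation Rinf := (perfect_closure pR).
Local Notation X := (fcover_base R p).

Lemma tensor_pc_unit_nat (S T : site) (g : fmor S T) (x : tensor M S) :
  tensor_map M (pc_map pR T) (tensor_map M g x) = tensor_map M (pc_map pR S) x.
Proof.
elim/tensor_ind: x => [|a m s x IH]; first by rewrite !linear0.
rewrite !linearP /= IH !tensor_mapE; congr (_ *: tens m _ + _).
exact: pc_map_nat.
Qed.

Lemma tensor_pc_unit_restr (S T : site) (g : fmor S T)
    (x : sections (tensor_presheaf p M) S) :
  tensor_map M (pc_map pR T) (restr g x) =
  @restr R p _ (constant_presheaf R p (tensor M Rinf : ModCat R)) _ _ g
    (tensor_map M (pc_map pR S) x).
Proof. exact: tensor_pc_unit_nat. Qed.

Definition tensor_pc_unit :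
    pshmor (tensor_presheaf p M) (constant_presheaf R p (tensor M Rinf : ModCat R)) :=
  @Pshmor R p (ModCat R) (tensor_presheaf p M) (constant_presheaf R p (tensor M Rinf : ModCat R))
    (fun S => tensor_map M (pc_map pR S) : {linear tensor M S -> tensor M Rinf})
    tensor_pc_unit_restr.

(** Tensoring with [M] preserves the colimit: for fixed [m] the maps [phi S (tens m s)] factor
    through [Rinf], and the factors [u m] form a bilinear map, as seen in a common cover. *)
Lemma tensor_pc_factor (W : lmodType R) (phi : forall S : site, tensor M S -> W) :
  (forall S, linear (@phi S)) ->
  (forall (S T : site) (h : fmor S T) x, phi T (tensor_map M h x) = phi S x) ->
  exists w : {linear tensor M Rinf -> W},
    (forall S x, w (tensor_map M (pc_map pR S) x) = phi S x) /\
    forall w' : {linear tensor M Rinf -> W},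
      (forall S x, w' (tensor_map M (pc_map pR S) x) = phi S x) -> w' =1 w.
Proof.
move=> phiL phi_nat.
have /choice[u uP] (m : M) : exists u : Rinf -> W,
    forall (S : site) s, u (pc_map pR S s) = phi S (tens m s).
  apply: (@pc_map_factor R p pR W (fun S s => phi S (tens m s))) => S T h s.
  by rewrite -(phi_nat _ _ h) tensor_mapE.
have ur m : linear (u m).
  move=> a r1 r2; have [S [s1 [s2 [<- <-]]]] := pc_map_cover2 r1 r2.
  by rewrite -linearP !uP tensDr tensZr phiL.
have ul r : linear (u^~ r).
  by move=> a m1 m2; have [S [s <-]] := pc_map_cover r; rewrite !uP tensDl tensZl phiL.
have [w wE] : exists w : {linear tensor M Rinf -> W}, forall m r, w (tens m r) = u m r.
  exists (HB.pack (tensor_lift u) (GRing.isLinear.Build R (tensor M Rinf) W *:%R _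
    (tensor_lift_linear ul ur)) : {linear tensor M Rinf -> W}).
  exact: tensor_liftE.
exists w; split=> [S|w' w'P].
  elim/tensor_ind => [|a m s x IH].
    by have := phiL S (-1) 0 0; rewrite scaler0 addr0 scaleN1r addNr => ->; rewrite !linear0.
  by rewrite !linearP phiL /= IH tensor_mapE wE uP.
elim/tensor_ind => [|a m r x IH]; first by rewrite !linear0.
rewrite !linearP /= IH wE; have [S [s <-]] := pc_map_cover r.
by rewrite uP -w'P tensor_mapE.
Qed.

Lemma tensor_pc_univ (G : presheaf R p (ModCat R)) (Gsheaf : is_sheaf G)
    (t : pshmor (tensor_presheaf p M) G) :
  exists u : pshmor (constant_presheaf R p (tensor M Rinf : ModCat R)) G,
    (forall S x, pm_app u (pm_app tensor_pc_unit x) = pm_app t x :> sections G S) /\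
    (forall v : pshmor (constant_presheaf R p (tensor M Rinf : ModCat R)) G,
       (forall S x, pm_app v (pm_app tensor_pc_unit x) = pm_app t x :> sections G S) ->
       forall S (x : sections (constant_presheaf R p (tensor M Rinf : ModCat R)) S),
         pm_app v x = pm_app u x).
Proof.
apply: (constant_univ (pR := pR)) Gsheaf t => {}G phi Gsheaf t phiP phi_nat.
apply: (@tensor_pc_factor (G X) phi) => //.
move=> S a x y; apply: (restr_inj Gsheaf (g := fmor_str pR S)).
rewrite [RHS](linearP (psh_map G (fmor_str pR S) : {linear _ -> _})).
rewrite phiP [LHS](linearP (pm_obj t S : {linear _ -> _})).
by congr (_ *: _ + _); rewrite -[LHS]phiP.
Qed.

Definition tensor_sheafification : sheafification (tensor_presheaf p M) :=
  Sheafification (@constant_is_sheaf R p (ModCat R) (tensor M Rinf)) tensor_pc_univ.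

End ModuleSheafification.

(** * The constant sheaf on [Rinf] as ring sheafification *)

Section RingSheafification.
Variables (R : comNzRingType) (p : nat) (pR : p \in [pchar R]).
Local Notation site := (fcover R p).
Local Notation Rinf := (perfect_closure pR).
Local Notation X := (fcover_base R p).

Lemma pc_unit_nat (S T : site) (g : fmor S T) (x : sections (ring_presheaf R p) S) :
  pc_map pR T (restr g x) =
  @restr R p _ (constant_presheaf R p (Rinf : CRingCat)) _ _ g (pc_map pR S x).
Proof. exact: pc_map_nat. Qed.

Definition pc_unit : pshmor (ring_presheaf R p) (constant_presheaf R p (Rinf : CRingCat)) :=
  @Pshmor R p CRingCat (ring_presheaf R p) (constant_presheaf R p (Rinf : CRingCat))
    (fun S => pc_map pR S : {rmorphism S -> Rinf}) pc_unit_nat.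

Lemma pc_factor (W : comPzRingType) (phi : forall S : site, S -> W) :
  (forall S, zmod_morphism (@phi S)) -> (forall S, monoid_morphism (@phi S)) ->
  (forall (S T : site) (h : fmor S T) x, phi T (h x) = phi S x) ->
  exists w : {rmorphism Rinf -> W},
    (forall S x, w (pc_map pR S x) = phi S x) /\
    forall w' : {rmorphism Rinf -> W},
      (forall S x, w' (pc_map pR S x) = phi S x) -> w' =1 w.
Proof.
move=> phiB phiM phi_nat; have [u uP] := pc_map_factor pR phi_nat.
have uB : zmod_morphism u.
  move=> r1 r2; have [S [s1 [s2 [<- <-]]]] := pc_map_cover2 r1 r2.
  by rewrite -rmorphB !uP phiB.
have uM : monoid_morphism u.
  split=> [|r1 r2]; first by rewrite -(rmorph1 (pc_map pR X)) uP (phiM _).1.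
  have [S [s1 [s2 [<- <-]]]] := pc_map_cover2 r1 r2.
  by rewrite -rmorphM !uP (phiM _).2.
exists (HB.pack u (GRing.isZmodMorphism.Build _ _ _ uB)
  (GRing.isMonoidMorphism.Build _ _ _ uM) : {rmorphism Rinf -> W}).
split=> // w' w'P r; have [S [s <-]] := pc_map_cover r.
by rewrite w'P /= uP.
Qed.

Lemma pc_univ (G : presheaf R p CRingCat) (Gsheaf : is_sheaf G)
    (t : pshmor (ring_presheaf R p) G) :
  exists u : pshmor (constant_presheaf R p (Rinf : CRingCat)) G,
    (forall S x, pm_app u (pm_app pc_unit x) = pm_app t x :> sections G S) /\
    (forall v : pshmor (constant_presheaf R p (Rinf : CRingCat)) G,
       (forall S x, pm_app v (pm_app pc_unit x) = pm_app t x :> sections G S) ->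
       forall S (x : sections (constant_presheaf R p (Rinf : CRingCat)) S),
         pm_app v x = pm_app u x).
Proof.
apply: (constant_univ (pR := pR)) Gsheaf t => {}G phi Gsheaf t phiP phi_nat.
pose rho S : {rmorphism G X -> G S} := psh_map G (fmor_str pR S).
pose tau (S : site) : {rmorphism S -> G S} := pm_obj t S.
have rhoP S x : rho S (phi S x) = tau S x by apply: phiP.
have rhoI S : injective (rho S) by apply: (restr_inj Gsheaf (g := fmor_str pR S)).
apply: (@pc_factor (G X) phi) => //.
  by move=> S x y; apply: (rhoI S); rewrite rmorphB !rhoP rmorphB.
move=> S; split=> [|x y]; apply: (rhoI S); first by rewrite rhoP !rmorph1.
by rewrite rmorphM !rhoP rmorphM.
Qed.

Definition ring_sheafification : sheafification (ring_presheaf R p) :=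
  Sheafification (@constant_is_sheaf R p CRingCat Rinf) pc_univ.

End RingSheafification.

(** * The unit isomorphism of the tensor product *)

Section TensorUnit.
Variables (R : comNzRingType) (N : lmodType R).

Lemma tensor_unit_iso : exists2 f : {linear tensor R^o N -> N},
  bijective f & forall (a : R^o) n, f (tens a n) = (a : R) *: n.
Proof.
have bl (n : N) : linear (fun a : R^o => (a : R) *: n).
  by move=> c a b; rewrite scalerDl scalerA.
have br (a : R^o) : linear (fun n : N => (a : R) *: n).
  by move=> c m n; rewrite scalerDr !scalerA mulrC.
pose f : {linear tensor R^o N -> N} :=
  HB.pack (tensor_lift (fun (a : R^o) n => (a : R) *: n))
    (GRing.isLinear.Build R (tensor R^o N) N *:%R _ (tensor_lift_linear bl br)).
have fE (a : R^o) n : f (tens a n) = (a : R) *: n by apply: tensor_liftE.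
exists f => //; exists (tens (1 : R^o)) => [x|n]; last by rewrite fE scale1r.
elim/tensor_ind: x => [|c a n x IH].
  rewrite linear0; apply: (addrI (tens (1 : R^o) (0 : N))).
  by rewrite -tensDr !addr0.
rewrite linearP tensDr tensZr IH fE tensZr -tensZl.
by rewrite [_ *: (1 : R^o)]mulr1.
Qed.

End TensorUnit.

(** * Sections of an arbitrary sheafification over a cover *)

Theorem theorem4p3p3 (R : comNzRingType) (k : fieldType) (iota : {rmorphism k -> R})
    (p : nat) (hp : p \in [pchar k]) :
  let Rinf := perfect_closure (rmorph_pchar iota hp) in
  let X := fcover_base R p in
  [/\ (forall M : lmodType R,
         inhabited (sheafification (tensor_presheaf p M)) /\
         forall F : sheafification (tensor_presheaf p M),
         exists theta : forall Y : fcover R p,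
             {linear (F Y : lmodType R) -> tensor M Rinf},
           [/\ forall Y, bijective (theta Y),
               forall (Y Z : fcover R p) (g : fmor Y Z) (x : sections F Y),
                 theta Z (restr g x) = theta Y x
             & forall Y : fcover R p, exists kappa : {lrmorphism Y -> Rinf},
                 forall (m : M) (s : Y),
                   theta Y (pm_app (shf_unit F) (tens m s)) = tens m (kappa s)]),
      (forall O : sheafification (tensor_presheaf p R^o),
         exists2 theta : {linear (O X : lmodType R) -> Rinf}, bijective theta &
           forall a b : R^o, theta (pm_app (S := X) (shf_unit O) (tens a b)) = (a * b : R)%:A)
    & inhabited (sheafification (ring_presheaf R p)) /\
      (forall O : sheafification (ring_presheaf R p),
         exists2 theta : {rmorphism (O X : comPzRingType) -> Rinf}, bijective theta &
           forall a : R, theta (pm_app (S := X) (shf_unit O) a) = a%:A) ].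
Proof.
move=> Rinf X; pose pR := rmorph_pchar iota hp.
have pc_mapX (a : R) : pc_map pR X a = a%:A.
  by rewrite -(rmorph_alg (pc_map pR X) a); congr (pc_map pR X _); rewrite [RHS]mulr1.
split.
- move=> M; split; first exact: (inhabits (tensor_sheafification pR M)).
  (* Sheafifications of one presheaf are isomorphic, so [F] is compared with the constant one, whose
     restrictions are identities. *)
  move=> F; have [u [uP u_bij]] := sheafification_iso F (tensor_sheafification pR M).
  exists (fun Y => pm_obj u Y : {linear (F Y : lmodType R) -> tensor M Rinf}).
  split=> [Y|Y Z g x|Y]; first exact: u_bij.
    by have := pm_nat u g x.
  by exists (pc_map pR Y) => m s; rewrite [LHS]uP; apply: tensor_mapE.
- move=> O; have [u [uP u_bij]] := sheafification_iso O (tensor_sheafification pR R^o).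
  have [f f_bij fE] := tensor_unit_iso Rinf.
  exists (f \o (pm_obj u X : {linear (O X : lmodType R) -> tensor R^o Rinf})).
    exact: (bij_comp f_bij (u_bij X)).
  move=> a b; rewrite /= [X in f X]uP /= tensor_mapE fE.
  by rewrite -scalerA; congr (_ *: _); apply: pc_mapX.
- split; first exact: (inhabits (ring_sheafification pR)).
  move=> O; have [u [uP u_bij]] := sheafification_iso O (ring_sheafification pR).
  exists (pm_obj u X : {rmorphism (O X : comPzRingType) -> Rinf}); first exact: u_bij.
  by move=> a; rewrite [LHS]uP; apply: pc_mapX.
Qed.
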